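(* Let $G$ be a 2-connected 4-regular planar graph, possibly with multiple edges. Let $\hat G$ and $\hat G'$ be any two planar embeddings of $G$, and let $C$ and $C'$ be the threaded circuit partitions of the plane graphs $\hat G$ and $\hat G'$, respectively. Then $|C| = |C'|$.
   Context: A plane graph is a graph with a fixed planar embedding, encoded by the cyclic counterclockwise order of edge-ends (half-edges) at each vertex. Threads. In a 4-regular plane graph, let $h_0,h_1,h_2,h_3$ be the edge-ends at a vertex $\beta$ in cyclic order. The two threads with midpoint $\beta$ are the pairs of non-consecutive edge-ends $\{h_0,h_2\}$ and $\{h_1,h_3\}$. Equivalently, a thread is a two-edge path $(\alpha,\beta,\gamma)$ whose edge-ends at $\beta$ are not contiguous in the cyclic order around $\beta$. For each edge traversal $(\alpha,\beta)$ there is a unique thread $(\alpha,\beta,\gamma)$. Threaded circuits. A circuit is a cyclic sequence of distinct edges $(e_0,\dots,e_{k-1})$ with $e_i=(u_i,u_{i+1})$, indices mod $k$. It is threaded if each $(u_{j-1},u_j,u_{j+1})$ is a thread. Threaded circuit partition. A threaded circuit partition is a set of threaded circuits in which each edge lies in exactly one circuit. Every 4-regular plane graph has exactly one threaded circuit partition, so the partition depends on the chosen embedding. *)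

(* Defs.v *)
From mathcomp Require Import all_boot fingroup perm.
Set Implicit Arguments. Unset Strict Implicit. Unset Printing Implicit Defensive.

(* A finite multigraph: vertex type V, edge type E, and for each edge e its two
   ends [ends e false], [ends e true].  Edge-ends (half-edges, "darts") are the
   pairs (e, b) : E * bool; the edge-end (e,b) lies at the vertex [ends e b]. *)
Section Graph.
Variables (V E : finType) (ends : E -> bool -> V).

Definition dart := (E * bool)%type.
Definition dvert (d : dart) : V := ends d.1 d.2.
Definition flip (d : dart) : dart := (d.1, ~~ d.2).

Definition loopless : Prop := forall e : E, ends e false != ends e true.

Definition degree (x : V) : nat := #|[set d : dart | dvert d == x]|.
Definition four_regular : Prop := forall x : V, degree x = 4.

Definition adj (x y : V) : bool :=
  [exists e : E, ((ends e false == x) && (ends e true == y))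
              || ((ends e false == y) && (ends e true == x))].

Definition adj_minus (v : V) (x y : V) : bool := [&& x != v, y != v & adj x y].

Definition connected_graph : Prop := forall x y : V, connect adj x y.

Definition two_connected : Prop :=
  2 < #|V| /\ forall v x y : V, x != v -> y != v -> connect (adj_minus v) x y.

(* A rotation system: a permutation of the edge-ends whose cycles are exactly
   the sets of edge-ends at each vertex (the cyclic order around each vertex). *)
Definition rotation_system (sigma : {perm dart}) : Prop :=
  (forall d : dart, dvert (sigma d) = dvert d) /\
  (forall d d' : dart, dvert d = dvert d' -> fconnect sigma d d').

Definition face_perm (sigma : {perm dart}) (d : dart) : dart := sigma (flip d).
Definition nfaces (sigma : {perm dart}) : nat := fcard (face_perm sigma) predT.

(* A planar embedding (plane graph) of the connected graph: a rotation system of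
   genus 0, i.e. satisfying Euler's formula V - E + F = 2. *)
Definition planar_embedding (sigma : {perm dart}) : Prop :=
  rotation_system sigma /\ #|V| + nfaces sigma = #|E| + 2.

(* Threads: at a degree-4 vertex with edge-ends h0,h1,h2,h3 in cyclic order
   (h_{i+1} = sigma h_i), the threads are {h0,h2} and {h1,h3}: the edge-end
   opposite to h is sigma (sigma h). *)
Definition is_thread (sigma : {perm dart}) (h h' : dart) : bool :=
  h' == sigma (sigma h).

(* A circuit is encoded by the cyclic sequence of edge-ends d_0,...,d_{k-1},
   where d_i = the end of edge e_i at u_i (so flip d_i is its end at u_{i+1}).
   It is threaded if for each i, the edge-ends flip d_i and d_{i+1} at u_{i+1}
   form a thread (indices mod k).  Edges must be distinct. *)
Definition threaded_step (sigma : {perm dart}) (d d' : dart) : bool :=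
  is_thread sigma (flip d) d'.

Definition threaded_circuit (sigma : {perm dart}) (c : seq dart) : Prop :=
  [/\ c != [::], uniq (map fst c) & path.cycle (threaded_step sigma) c].

(* A threaded circuit partition, given as a list of circuits (one
   representative cyclic sequence per circuit) such that every edge lies in
   exactly one circuit.  Its cardinality is the length of the list. *)
Definition threaded_circuit_partition (sigma : {perm dart})
    (cs : seq (seq dart)) : Prop :=
  (forall c, c \in cs -> threaded_circuit sigma c) /\
  (forall e : E, count (fun c => e \in map fst c) cs = 1).

End Graph.

(* Main.v *)
Require Import Defs.
From mathcomp Require Import all_boot fingroup perm.
From mathcomp Require Import all_algebra zify.

(** Over F_2 (realised as the field [bool]), a threaded circuit partition with c
    circuits gives 2^c functions x on the edges that are constant along
    threads.  Such an x is determined, up to a constant, by the vertex function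
    y(v) = x(h) + x(sigma h), h any edge-end at v.  By planarity, y arises from
    some x iff it sums to 0 around every face.  So it suffices that a y coming
    from one embedding sums to 0 around every face F of the other one.

    The vertices that F passes through a corner of sigma contribute a
    telescoping sum; there remain the straight ones, where the two edge-ends of
    F are opposite for sigma.  At a straight vertex consider the face G of
    sigma' at the corner opposite to F.  Two vertices with the same G can be
    joined by a closed curve through F and G, and the handshake lemma inside
    that curve shows that they have the same y.  Finally, each G has an even
    number of straight corners: F, seen in the first embedding, bounds a set of
    faces, and along G one switches side exactly at the straight corners. *)

Set Implicit Arguments. Unset Strict Implicit. Unset Printing Implicit Defensive.
Import GRing.Theory.
Local Open Scope ring_scope.

(** * Linear algebra: exactness from an Euler count *)

(** The two kernel hypotheses bound the ranks of [b0] and [b1] from below by [#|T0| - 1] and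
    [#|T2| - 1]. By the Euler relation the kernel of [b1] then has dimension at most the rank of
    [b0], whose image it contains, so the two coincide. *)
Lemma exact_of_euler (K : fieldType) (T0 T1 T2 : finType)
    (b0 : T0 -> T1 -> K) (b1 : T1 -> T2 -> K) :
  (forall i k, \sum_j b0 i j * b1 j k = 0) ->
  (forall a : T0 -> K, (forall j, \sum_i a i * b0 i j = 0) ->
    forall i i', a i = a i') ->
  (forall c : T2 -> K, (forall j, \sum_k b1 j k * c k = 0) ->
    forall k k', c k = c k') ->
  (#|T0| + #|T2| = #|T1| + 2)%N ->
  forall p : T1 -> K, (forall k, \sum_j p j * b1 j k = 0) ->
  exists a : T0 -> K, forall j, p j = \sum_i a i * b0 i j.
Proof.
move=> b01 ker0 ker1 euler p pb1.
pose B0 := \matrix_(i < #|T0|, j < #|T1|) b0 (enum_val i) (enum_val j).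
pose B1 := \matrix_(i < #|T1|, j < #|T2|) b1 (enum_val i) (enum_val j).
have sumE (T : finType) (F : T -> K) : \sum_i F i = \sum_(i < #|T|) F (enum_val i).
  by rewrite (reindex _ (onW_bij _ (enum_val_bij T))).
have rank1 n (M : 'M[K]_n) :
    (forall i (k k' : 'I_n), M i k = M i k') -> (\rank M <= 1)%N.
  move=> constM; have [n0|n_gt0] := posnP n.
    by apply: leq_trans (rank_leq_row _) _; rewrite n0.
  suff le1 : (M <= (const_mx 1 : 'rV_n))%MS.
    exact: leq_trans (mxrankS le1) (rank_leq_row _).
  apply/row_subP=> i; apply/sub_rVP; exists (M i (Ordinal n_gt0)).
  by apply/rowP=> k; rewrite !mxE mulr1; apply: constM.
have rkB m n (B : 'M[K]_(m, n)) :
    (forall a : 'rV_m, a *m B = 0 -> forall k k', a 0 k = a 0 k') ->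
    (m <= (\rank B).+1)%N.
  move=> kerB; rewrite -addn1 -leq_subLR -mxrank_ker.
  move: (kermx B) (mulmx_ker B) => M M0; apply: rank1 => r k k'.
  have /kerB/(_ k k') : row r M *m B = 0 by rewrite -row_mul M0 row0.
  by rewrite !mxE.
have rk0 : (#|T0| <= (\rank B0).+1)%N.
  apply: rkB => a aB k k'.
  rewrite -[k]enum_valK -[k']enum_valK; move: (enum_val k) (enum_val k').
  apply: (ker0 (fun i => a 0 (enum_rank i))) => j; rewrite sumE.
  have /rowP/(_ (enum_rank j)) := aB; rewrite !mxE => aBj.
  apply: etrans aBj; apply: eq_bigr => i _.
  by rewrite !mxE !enum_valK enum_rankK.
have rk1 : (#|T2| <= (\rank B1).+1)%N.
  rewrite -mxrank_tr; apply: rkB => a aB k k'.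
  rewrite -[k]enum_valK -[k']enum_valK; move: (enum_val k) (enum_val k').
  apply: (ker1 (fun i => a 0 (enum_rank i))) => j; rewrite sumE.
  have /rowP/(_ (enum_rank j)) := aB; rewrite !mxE => aBj.
  apply: etrans aBj; apply: eq_bigr => i _.
  by rewrite !mxE !enum_valK enum_rankK mulrC.
have sub01 : (B0 <= kermx B1)%MS.
  apply/sub_kermxP/matrixP=> i k; rewrite !mxE; apply: etrans (b01 (enum_val i) (enum_val k)).
  by rewrite [RHS]sumE; apply: eq_bigr => j _; rewrite !mxE.
have sub10 : (kermx B1 <= B0)%MS.
  rewrite -(mxrank_leqif_sup sub01) eqn_leq (mxrankS sub01) mxrank_ker.
  rewrite leq_subLR -(leq_add2r 2) -euler.
  by rewrite addnC -[2%N]/(1 + 1)%N addnACA !addn1 leq_add.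
pose P := \row_(j < #|T1|) p (enum_val j).
have /submxP[a defP] : (P <= B0)%MS.
  apply: submx_trans sub10; apply/sub_kermxP/rowP=> k; rewrite !mxE.
  apply: etrans (pb1 (enum_val k)); rewrite [RHS]sumE.
  by apply: eq_bigr => j _; rewrite !mxE.
exists (fun i => a 0 (enum_rank i)) => j.
have /rowP/(_ (enum_rank j)) := defP; rewrite !mxE enum_rankK => ->.
by rewrite [RHS]sumE; apply: eq_bigr => i _; rewrite !mxE enum_valK enum_rankK.
Qed.

(** * Rotation systems of a 4-regular graph and planar cohomology *)

Section Rotation.
Variables (V E : finType) (ends : E -> bool -> V).
Hypothesis Hreg : four_regular ends.
Variable s : {perm dart E}.
Hypothesis Hrot : rotation_system ends s.

Implicit Types d h k : dart E.

Lemma flipK : involutive (@flip E).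
Proof. by case=> e b; rewrite /flip /= negbK. Qed.

Lemma rotation_connect d h : fconnect s d h = (dvert ends h == dvert ends d).
Proof.
have [sv vs] := Hrot; apply/idP/eqP=> [/iter_findex <-|/esym/vs //].
by elim: (findex s d h) => //= n <-; apply: sv.
Qed.

Lemma rotation_order d : fingraph.order s d = 4%N.
Proof.
rewrite -(Hreg (dvert ends d)); apply: eq_card => h.
by rewrite [in RHS]inE -rotation_connect.
Qed.

Lemma rotation4 d : s (s (s (s d))) = d.
Proof. by have := iter_order (@perm_inj _ s) d; rewrite rotation_order. Qed.

Lemma rotation_uniq d : uniq [:: d; s d; s (s d); s (s (s d))].
Proof. by have := orbit_uniq s d; rewrite /orbit rotation_order. Qed.

Lemma rotation_vertex d k :
  (dvert ends k == dvert ends d) = (k \in [:: d; s d; s (s d); s (s (s d))]).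
Proof. by rewrite -rotation_connect fconnect_orbit /orbit rotation_order. Qed.

Lemma sum_vertex (R : nmodType) (F : dart E -> R) d :
  \sum_(k | dvert ends k == dvert ends d) F k
    = F d + F (s d) + F (s (s d)) + F (s (s (s d))).
Proof.
rewrite (eq_bigl _ _ (rotation_vertex d)) -big_uniq ?rotation_uniq //=.
by rewrite !big_cons big_nil addr0 !addrA.
Qed.

Lemma vertex_dart v : exists d, dvert ends d = v.
Proof.
have /card_gt0P[d] : (0 < degree ends v)%N by rewrite Hreg.
by rewrite inE => /eqP; exists d.
Qed.

Lemma face_perm_inj : injective (face_perm s).
Proof. by move=> d d' /perm_inj/(inv_inj flipK). Qed.

Lemma dvert_rotation d : dvert ends (s d) = dvert ends d.
Proof. exact: (proj1 Hrot). Qed.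

(* The corner between k and s k lies on the face of s k, cf. mem_face_flip. *)
Definition face d : {set dart E} := [set k | fconnect (face_perm s) d k].

Lemma face_refl d : d \in face d.
Proof. by rewrite inE connect0. Qed.

Lemma mem_face_perm d k : (face_perm s k \in face d) = (k \in face d).
Proof. by rewrite !inE -(same_fconnect1_r face_perm_inj). Qed.

Lemma mem_face_flip d k : (flip k \in face d) = (s k \in face d).
Proof. by rewrite -mem_face_perm /face_perm flipK. Qed.

Lemma face_eq d k : k \in face d -> face k = face d.
Proof.
rewrite inE => dk; apply/setP=> h.
by rewrite !inE (same_connect (fconnect_sym face_perm_inj) dk).
Qed.

Hypothesis H2c : two_connected ends.

Lemma two_connected_connected : connected_graph ends.
Proof.
have [V2 conn] := H2c; move=> x y.
have [v] : exists v, v \notin [:: x; y].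
  apply/existsP; rewrite -negb_forall; apply: contraL V2 => /forallP Vxy.
  rewrite -leqNgt; apply: leq_trans (card_size [:: x; y]).
  by apply/subset_leq_card/subsetP=> v _.
rewrite !inE negb_or ![v == _]eq_sym => /andP[vx vy].
apply: connect_sub (conn v x y vx vy) => a b /and3P[_ _ ab].
exact: connect1.
Qed.

(** Connectedness read on edge-ends: [s] runs through all edge-ends at a vertex, and [flip] crosses
    an edge. *)
Lemma locally_constant (T : eqType) (A : dart E -> T) :
  (forall d, A (flip d) = A d) -> (forall d, A (s d) = A d) ->
  forall d d', A d = A d'.
Proof.
move=> Af As.
have Av d d' : dvert ends d = dvert ends d' -> A d = A d'.
  move=> /esym/eqP; rewrite rotation_vertex !inE.
  by case/or4P=> /eqP->; rewrite ?As.
have Aadj x y : connect (adj ends) x y ->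
    forall d d', dvert ends d = x -> dvert ends d' = y -> A d = A d'.
  case/connectP=> p; elim: p x => [|z p IHp] x /= => [_ -> d d' <- /esym/Av //|].
  case/andP=> /existsP[e xze] /IHp{}IHp /IHp{}IHp d d' dx d'y.
  case/orP: xze => /andP[/eqP ex /eqP ez].
    by rewrite -(IHp (e, true) d') // -(Af (e, true)) (Av d (e, false)) // dx.
  by rewrite -(IHp (e, false) d') // -(Af (e, false)) (Av d (e, true)) // dx.
by move=> d d'; apply: Aadj (two_connected_connected _ _) _ _ _ _.
Qed.

Hypothesis Hplanar : (#|V| + nfaces s = #|E| + 2)%N.

(* The hypermap (flip, s, face_perm s) has genus 0, so it is simply connected:
   a 1-cochain (u, w) that vanishes on every edge, vertex and face is exact. *)
Lemma planar_cochain (u w : dart E -> bool) :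
  (forall d, u (flip d) = u d) ->
  (forall d, \sum_(k | dvert ends k == dvert ends d) w k = 0) ->
  (forall d, \sum_(k in face d) (u k + w (flip k)) = 0) ->
  exists A : dart E -> bool,
    (forall d, A (flip d) = A d + u d) /\ (forall d, A (s d) = A d + w d).
Proof.
move=> uE wV uwF.
pose phi := face_perm s; have phiS := fconnect_sym face_perm_inj.
pose R := {d : dart E | froots phi d}.
pose rt d : R := Sub (froot phi d) (roots_root phiS d).
(* Points are the edge-ends. The arcs in [T1] join [d] to [flip d] ([inl]) and [d] to [s d] ([inr]).
   The cells in [T2] are the cycles of [flip], [s] and [face_perm s], a face being represented by
   its root. *)
pose T1 := (dart E + dart E)%type; pose T2 := (E + V + R)%type.
pose b0 (i : dart E) (j : T1) : bool :=
  match j with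
  | inl d => (i == d) + (i == flip d)
  | inr d => (i == d) + (i == s d)
  end.
pose b1 (j : T1) (k : T2) : bool :=
  match j, k with
  | inl d, inl (inl e) => d.1 == e
  | inr d, inl (inl e) => false
  | inl d, inl (inr v) => false
  | inr d, inl (inr v) => dvert ends d == v
  | inl d, inr r => rt d == r
  | inr d, inr r => rt (flip d) == r
  end.
have sum1 (F : T1 -> bool) : \sum_j F j = \sum_d F (inl d) + \sum_d F (inr d).
  exact: big_sumType.
have sum2 (F : T2 -> bool) : \sum_j F j = \sum_e F (inl (inl e))
    + \sum_v F (inl (inr v)) + \sum_r F (inr r).
  by rewrite !big_sumType.
have sumI (T : finType) (i : T) (F : T -> bool) : \sum_j F j * (j == i) = F i.
  rewrite (bigD1 i) //= eqxx mulr1 big1 ?addr0 // => j /negPf->.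
  by rewrite mulr0.
have addI (b : bool) : b + b = 0 by case: b.
have rt_phi d : rt (phi d) = rt d.
  by apply/esym/val_inj/eqP; rewrite /= root_connect // fconnect1.
have rtE r d : (rt d == r) = (d \in face (val r)).
  by rewrite -val_eqE inE /= -[X in _ == X](eqP (valP r)) eq_sym root_connect.
have b0E (a : dart E -> bool) j : \sum_i a i * b0 i j =
    match j with inl d => a d + a (flip d) | inr d => a d + a (s d) end.
  by case: j => d; under eq_bigr do rewrite mulrDr; rewrite big_split !sumI.
have b0E' i (F : T1 -> bool) : \sum_j b0 i j * F j =
    F (inl i) + F (inl (flip i)) + (F (inr i) + F (inr (s (s (s i))))).
  rewrite sum1; under eq_bigr do rewrite mulrDl.
  rewrite big_split; under [X in _ + X]eq_bigr do rewrite mulrDl.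
  rewrite big_split; congr (_ + _ + (_ + _)).
  - by apply: etrans (sumI _ i (F \o inl)); apply: eq_bigr => d _; rewrite mulrC eq_sym.
  - apply: etrans (sumI _ (flip i) (F \o inl)); apply: eq_bigr => d _.
    by rewrite mulrC -(inv_eq flipK) eq_sym.
  - by apply: etrans (sumI _ i (F \o inr)); apply: eq_bigr => d _; rewrite mulrC eq_sym.
  - apply: etrans (sumI _ (s (s (s i))) (F \o inr)); apply: eq_bigr => d _.
    by rewrite mulrC -(inj_eq (@perm_inj _ s)) rotation4 eq_sym.
have b1E (c : T2 -> bool) j : \sum_k b1 j k * c k =
    match j with
    | inl d => c (inl (inl d.1)) + c (inr (rt d))
    | inr d => c (inl (inr (dvert ends d))) + c (inr (rt (flip d)))
    end.
  case: j => d; rewrite sum2 /=.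
    rewrite [X in _ + X + _]big1 ?addr0 => [|? _]; last by rewrite mul0r.
    rewrite -[c (inl (inl d.1))](sumI _ _ (c \o inl \o inl)).
    rewrite -[c (inr _)](sumI _ _ (c \o inr)).
    by congr (_ + _); apply: eq_bigr => i _; rewrite mulrC eq_sym.
  rewrite [X in X + _ + _]big1 ?add0r => [|? _]; last by rewrite mul0r.
  rewrite -[c (inl (inr _))](sumI _ _ (c \o inl \o inr)).
  rewrite -[c (inr _)](sumI _ _ (c \o inr)).
  by congr (_ + _); apply: eq_bigr => i _; rewrite mulrC eq_sym.
have [] := @exact_of_euler _ _ _ _ b0 b1 _ _ _ _
  (fun j => match j with inl d => u d | inr d => w d end).
- move=> i k; rewrite b0E'; case: k => [[e|v]|r] /=; rewrite ?addI ?addr0 //.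
    by rewrite !dvert_rotation addI addr0.
  by rewrite -(rt_phi (flip (s (s (s i))))) /phi /face_perm flipK rotation4;
     do 2!case: (_ == r).
- move=> a a0; apply: locally_constant => d.
    by have := a0 (inl d); rewrite b0E; case: (a d) (a (flip d)) => [] [].
  by have := a0 (inr d); rewrite b0E; case: (a d) (a (s d)) => [] [].
(* Every cell shares an arc with a face, so it carries the value of that face; the two faces along
   an edge agree, and connectedness finishes. *)
- move=> c c0.
  have cE d : c (inl (inl d.1)) = c (inr (rt d)).
    by have := c0 (inl d); rewrite b1E; do 2!case: (c _).
  have cV d : c (inl (inr (dvert ends d))) = c (inr (rt (flip d))).
    by have := c0 (inr d); rewrite b1E; do 2!case: (c _).
  have cflip d : c (inr (rt (flip d))) = c (inr (rt d)) by rewrite -!cE.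
  have cR d d' : c (inr (rt d)) = c (inr (rt d')).
    apply: (locally_constant (A := fun d => c (inr (rt d)))) => // h.
    by rewrite -cflip -cV dvert_rotation // cV cflip.
  have cT t : exists d, c t = c (inr (rt d)).
    case: t => [[e|v]|r].
    - by exists (e, true); rewrite -cE.
    - by have [d <-] := vertex_dart v; exists (flip d).
    - exists (val r); congr (c (inr _)); apply: val_inj => /=.
      by rewrite (eqP (valP r)).
  by move=> t t'; have [d ->] := cT t; have [d' ->] := cT t'.
- rewrite !card_sum card_sig card_prod card_bool.
  have -> : #|[pred d | froots phi d]| = nfaces s.
    by apply: eq_card => d; rewrite !inE andbT.
  by have := Hplanar; lia.
- case=> [[e|v]|r]; rewrite sum1 /=.
  - rewrite [X in _ + X]big1 ?addr0 => [|d _]; last by rewrite mulr0.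
    transitivity (\sum_(e' : E) \sum_(b : bool) u (e', b) * (e' == e)).
      by rewrite pair_bigA; apply: eq_bigr => -[].
    under eq_bigr do rewrite -mulr_suml.
    by rewrite sumI big_bool /= (uE (e, false)) addI.
  - rewrite [X in X + _]big1 ?add0r => [|d _]; last by rewrite mulr0.
    have [d <-] := vertex_dart v; apply: etrans (wV d); rewrite [RHS]big_mkcond.
    by apply: eq_bigr => h _; case: eqP; rewrite ?mulr1 ?mulr0.
  - rewrite [X in _ + X](reindex_inj (inv_inj flipK)) -big_split /=.
    apply: etrans (uwF (val r)); rewrite [RHS]big_mkcond; apply: eq_bigr => h _.
    by rewrite flipK rtE; case: ifP; rewrite ?mulr1 ?mulr0.
move=> A AE; exists A; split=> d.
  by have := AE (inl d); rewrite b0E => ->; rewrite addrA addI add0r.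
by have := AE (inr d); rewrite b0E => ->; rewrite addrA addI add0r.
Qed.

Lemma rotation_vertexP d k : dvert ends k = dvert ends d ->
  [\/ k = d, k = s d, k = s (s d) | k = s (s (s d))].
Proof.
by move/eqP; rewrite rotation_vertex !inE => /or4P[] /eqP->;
  [constructor 1|constructor 2|constructor 3|constructor 4].
Qed.

Lemma rotation_neq d :
  ((s d == d) = false) * ((s (s d) == d) = false) * ((s (s (s d)) == d) = false) *
  ((d == s d) = false) * ((d == s (s d)) = false) * ((d == s (s (s d))) = false).
Proof.
have := rotation_uniq d; rewrite /= !inE ![d == _]eq_sym.
by case: (s d == d); case: (_ == d); case: (_ == d).
Qed.

(** * Closed curves through corners, and simplicity of faces *)

(** A discrete Jordan curve theorem. An entry [c] stands for the corner between [c] and [s c]. If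
    every vertex and every face has an even number of listed corners, these link up to closed
    curves, and [P] is the set of edges inside. *)
Lemma corner_cut (cs : seq (dart E)) :
  (forall v, \sum_(c <- cs) (dvert ends c == v) = 0 :> bool) ->
  (forall d, \sum_(c <- cs) (s c \in face d) = 0 :> bool) ->
  exists P : dart E -> bool, (forall d, P (flip d) = P d) /\
    (forall d, P (s d) = P d + \sum_(c <- cs) (d == c)).
Proof.
move=> csV csF.
have sum_pred (Q : pred (dart E)) c : \sum_(k | Q k) (k == c) = Q c :> bool.
  rewrite big_mkcond (bigD1 c) //= eqxx big1 ?addr0 => [|k /negPf->]; first by case: (Q c).
  by case: (Q k).
have [//|d|d|P [Pf Ps]] := @planar_cochain (fun=> false) (fun k => \sum_(c <- cs) (k == c)).
- by rewrite exchange_big -[RHS](csV (dvert ends d)); apply: eq_bigr => c _ /=; rewrite sum_pred.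
- rewrite -[RHS](csF d); under eq_bigr do rewrite add0r.
  rewrite exchange_big; apply: eq_bigr => c _ /=.
  rewrite -mem_face_flip; apply: etrans (sum_pred (mem (face d)) (flip c)).
  by apply: eq_bigr => k _; rewrite (inv_eq flipK).
- by exists P; split=> // d; rewrite Pf addr0.
Qed.

Hypothesis Hloop : loopless ends.

Lemma dvert_flip d : dvert ends (flip d) != dvert ends d.
Proof. by case: d => e []; rewrite /dvert /= ?Hloop // eq_sym Hloop. Qed.

(* If a face had two corners at v, the curve through that face and v would
   separate the edges at v, making v a cut vertex. *)
Lemma face_simple d k : dvert ends k = dvert ends d -> k \in face d -> k = d.
Proof.
move=> dk kd; apply/eqP/negPn/negP=> /negPf k'd.
(* These are the corners just before [d] and just before [k]: same vertex, same face. *)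
have [| |P [Pf Ps]] := @corner_cut [:: s (s (s d)); s (s (s k))].
- by move=> v; rewrite !big_cons big_nil !dvert_rotation // dk; case: (_ == v).
- move=> h; rewrite !big_cons big_nil !rotation4.
  suff -> : (k \in face h) = (d \in face h) by case: (d \in _).
  apply/esym; rewrite !inE in kd *.
  exact: (same_connect_r (fconnect_sym face_perm_inj)).
have Poff h : dvert ends h != dvert ends d ->
    forall h', dvert ends h' = dvert ends h -> P h' = P h.
  move=> h'd.
  have Pc j : dvert ends j = dvert ends h -> P (s j) = P j.
    move=> jh; rewrite Ps !big_cons big_nil.
    have neq c : dvert ends c = dvert ends d -> (j == c) = false.
      by move=> cd; apply: contraNF h'd => /eqP jc; rewrite -jh jc cd.
    by rewrite !neq ?dvert_rotation // !addr0.
  by move=> h' /rotation_vertexP[] ->; rewrite ?Pc // !dvert_rotation.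
pose h := s (s (s d)).
have hd : dvert ends h = dvert ends d by rewrite !dvert_rotation.
have Pd : P d = ~~ P h.
  rewrite -{1}(rotation4 d) Ps !big_cons big_nil eqxx !(inj_eq perm_inj) eq_sym k'd.
  by rewrite -/h; case: (P h).
suff : P d = P h by rewrite Pd; case: (P h).
(* The neighbours of the vertex along [d] and [h] are joined by a path avoiding it, and [P] does not
   change along such a path. *)
rewrite -Pf -[RHS]Pf.
have /connectP[p] := proj2 H2c (dvert ends d) _ _ (dvert_flip d)
  (etrans (congr1 (fun v => _ != v) (esym hd)) (dvert_flip h)).
move: (flip d) (flip h) (dvert_flip d) => a b.
elim: p a => [|z p IHp] a av /= => [_ /esym ba|]; first by rewrite (Poff b) // -?ba // -ba.
case/andP=> /and3P[_ zv /existsP[e eaz]] pp lb.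
have [j jE jP] : exists2 j, dvert ends j = z & P j = P a.
  case/orP: eaz => /andP[/eqP ea /eqP ez].
    by exists (e, true); rewrite // -Pf; apply: Poff.
  by exists (e, false); rewrite // -Pf; apply: Poff.
by rewrite -jP; apply: IHp; rewrite jE.
Qed.

End Rotation.

(** * The handshake lemma and curves through one face *)

Lemma sum_flip_invariant (E : finType) (t : dart E -> bool) :
  (forall d, t (flip d) = t d) -> \sum_d t d = 0.
Proof.
move=> tf; transitivity (\sum_(e : E) \sum_(b : bool) t (e, b)).
  by rewrite pair_bigA; apply: eq_bigr => -[].
by apply: big1 => e _; rewrite big_bool /= -(tf (e, false)) /flip /=; case: (t _).
Qed.

(** Over F_2 the two ends of each edge cancel, so the vertex sums add up to zero; only those at [v1]
    and [v2] can survive. *)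
Lemma handshake (V E : finType) (ends : E -> bool -> V) (t : dart E -> bool) v1 v2 :
  (forall d, t (flip d) = t d) -> v1 != v2 ->
  (forall v, v != v1 -> v != v2 -> \sum_(d | dvert ends d == v) t d = 0) ->
  \sum_(d | dvert ends d == v1) t d = \sum_(d | dvert ends d == v2) t d.
Proof.
move=> tf v12 t0; have := sum_flip_invariant tf.
rewrite (partition_big (dvert ends) predT) //= (bigD1 v1) //= (bigD1 v2) ?(eq_sym v2) //=.
rewrite [X in _ + (_ + X)]big1 => [|v /andP[]]; last exact: t0.
by rewrite addr0; do 2!case: (\sum_(d | _) _).
Qed.

Section OneFace.
Variables (V E : finType) (ends : E -> bool -> V).
Hypotheses (Hloop : loopless ends) (Hreg : four_regular ends)
  (H2c : two_connected ends).
Variable r : {perm dart E}.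
Hypotheses (Hrot : rotation_system ends r)
  (Hplanar : (#|V| + nfaces r)%N = (#|E| + 2)%N).
Variable d0 : dart E.
Let F := face r d0.

Implicit Types d h k : dart E.
Let r4 := rotation4 Hreg Hrot.
Let rneq := rotation_neq Hreg Hrot.
Let rV := dvert_rotation Hrot.

Lemma mem_face_vertex d k :
  d \in F -> dvert ends k = dvert ends d -> (k \in F) = (k == d).
Proof.
move=> dF kd; apply/idP/eqP=> [kF|-> //].
by apply: (face_simple Hreg Hrot H2c Hplanar Hloop) => //; rewrite (face_eq dF).
Qed.

Lemma mem_face_same a d k : d \in face r a -> k \in face r a ->
  forall h, (d \in face r h) = (k \in face r h).
Proof.
move=> da ka h; apply/idP/idP=> /face_eq <-;
by rewrite ?(face_eq da) ?(face_eq ka).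
Qed.

Lemma dart_neq d k : dvert ends d <> dvert ends k -> (d == k) = 0 :> bool.
Proof. by move=> dk; apply/negbTE/eqP=> e; apply: dk; rewrite e. Qed.

Lemma vertex_inj d k : d \in F -> k \in F -> d != k -> dvert ends d <> dvert ends k.
Proof. by move=> dF kF dk /(mem_face_vertex kF); rewrite dF (negPf dk). Qed.

(* P is the inside of the closed curve that runs through F and the face of
   r (r d1), and crosses the graph only at the vertices of d1 and d2. *)
Lemma two_vertex_cut d1 d2 c :
    d1 \in F -> d2 \in F -> d1 != d2 -> dvert ends c = dvert ends d2 ->
    r c \in face r (r (r d1)) ->
  exists P : dart E -> bool,
  [/\ forall d, P (flip d) = P d,
      forall d, dvert ends d = dvert ends d1 ->
        P (r d) = P d + ((d == r (r (r d1))) + (d == r d1)),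
      forall d, dvert ends d = dvert ends d2 ->
        P (r d) = P d + ((d == r (r (r d2))) + (d == c))
    & forall d k, dvert ends d != dvert ends d1 -> dvert ends d != dvert ends d2 ->
        dvert ends k = dvert ends d -> P k = P d].
Proof.
move=> d1F d2F d12 cd2 cG; have vne := vertex_inj d1F d2F d12.
(* At [d1] the curve uses the corner of [F], between [r (r (r d1))] and [d1], and the opposite one,
   starting at [r d1]. At [d2] it uses the corner of [F] and the corner [c]. *)
have [| |P [Pf Pr]] := @corner_cut _ _ _ Hreg _ Hrot H2c Hplanar
    [:: r (r (r d1)); r d1; r (r (r d2)); c].
- move=> v; rewrite !big_cons big_nil !rV cd2.
  by do 2!case: (_ == v).
- move=> h; rewrite !big_cons big_nil !r4.
  rewrite (mem_face_same d2F d1F) (mem_face_same cG (face_refl r _)).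
  by do 2!case: (_ \in _).
have {}Pr d : P (r d) = P d + ((d == r (r (r d1))) + (d == r d1)
    + ((d == r (r (r d2))) + (d == c))).
  by rewrite Pr !big_cons big_nil addr0 !addrA.
exists P; split=> // [d dd1|d dd2|d k /eqP dd1 /eqP dd2 kd].
- by rewrite Pr [d == r (r (r d2))]dart_neq ?[d == c]dart_neq ?rV ?cd2 ?dd1 // !addr0.
- by rewrite Pr [d == r (r (r d1))]dart_neq ?[d == r d1]dart_neq ?rV ?dd2 ?add0r //; apply/nesym.
- have Pd h : dvert ends h = dvert ends d -> P (r h) = P h.
    move=> hd; rewrite Pr !dart_neq ?rV ?cd2 ?hd //.
    by rewrite !addr0.
  by case: (rotation_vertexP Hreg Hrot kd) => ->; rewrite ?Pd // !rV.
Qed.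

(** The handshake lemma for the restriction [P * x] of [x] to the inside. At a vertex off the curve
    [P] is constant, so the sum there is a multiple of a vertex sum of [x], which is zero. *)
Lemma cut_handshake (x P : dart E -> bool) d1 d2 :
  (forall d, x (flip d) = x d) ->
  (forall d, \sum_(k | dvert ends k == dvert ends d) x k = 0) ->
  (forall d, P (flip d) = P d) -> dvert ends d1 <> dvert ends d2 ->
  (forall d k, dvert ends d != dvert ends d1 -> dvert ends d != dvert ends d2 ->
        dvert ends k = dvert ends d -> P k = P d) ->
  P d1 * x d1 + P (r d1) * x (r d1) + P (r (r d1)) * x (r (r d1))
    + P (r (r (r d1))) * x (r (r (r d1)))
  = P d2 * x d2 + P (r d2) * x (r d2) + P (r (r d2)) * x (r (r d2))
    + P (r (r (r d2))) * x (r (r (r d2))).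
Proof.
move=> xf xV Pf vne PV.
rewrite -!(sum_vertex Hreg Hrot (fun d => P d * x d)).
apply: handshake => [d||v]; [by rewrite Pf xf | exact/eqP|].
have [d <-] := vertex_dart Hreg v => dd1 dd2.
rewrite -[RHS](mulr0 (P d)) -[X in _ = _ * X](xV d) mulr_sumr.
by apply: eq_bigr => k /eqP kd; rewrite (PV d).
Qed.

(** Here the curve leaves both vertices through the corner opposite to [F], so it splits the four
    edge-ends there into the pairs [{d, r d}] and [{r (r d), r (r (r d))}]. *)
Lemma opposite_corners_eq (x : dart E -> bool) d1 d2 :
    (forall d, x (flip d) = x d) ->
    (forall d, \sum_(k | dvert ends k == dvert ends d) x k = 0) ->
    d1 \in F -> d2 \in F -> r (r d2) \in face r (r (r d1)) ->
  x (r (r (r d1))) + x (r (r d1)) = x (r (r (r d2))) + x (r (r d2)).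
Proof.
move=> xf xV d1F d2F d2G; have [->//|d12] := eqVneq d1 d2.
have vne := vertex_inj d1F d2F d12.
have [P [Pf P1 P2 PV]] := two_vertex_cut d1F d2F d12 (rV d2) d2G.
have := cut_handshake xf xV Pf vne PV.
have := xV d1; have := xV d2; rewrite !(sum_vertex Hreg Hrot).
have := (P1 d1 erefl, P1 (r d1) (rV _), P1 (r (r d1)) (etrans (rV _) (rV _))).
have := (P2 d2 erefl, P2 (r d2) (rV _), P2 (r (r d2)) (etrans (rV _) (rV _))).
rewrite !(inj_eq (@perm_inj _ r)) !eqxx !rneq => -[[-> ->] ->] [[-> ->] ->].
(* Around the vertex [P] takes the values p, p, p + 1, p + 1. The part with factor p is the full
   vertex sum. *)
have split_sum (p a b c e : bool) : p * a + (p + (false + false)) * b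
    + (p + (false + false) + (false + true)) * c
    + (p + (false + false) + (false + true) + (false + false)) * e
    = p * (a + b + c + e) + (e + c).
  by case: p; case: a; case: b; case: c; case: e.
by rewrite !split_sum => -> ->; rewrite !mulr0 !add0r.
Qed.

(* Otherwise the cut would have odd total degree. *)
Lemma opposite_face_disjoint d k :
  d \in F -> k \in F -> r k \in face r (r (r d)) = false.
Proof.
move=> dF kF; apply/negP=> kG; have [dk|d12] := eqVneq d k.
  have /eqP : r d = r (r d).
    by rewrite -dk in kG; apply: (face_simple Hreg Hrot H2c Hplanar Hloop) kG; rewrite !rV.
  by rewrite rneq.
have vne := vertex_inj dF kF d12.
(* With [c] equal to [k] the curve cuts off the single edge-end [k] at its vertex, but two edge-ends
   at the vertex of [d]. The handshake lemma for the constant function 1 forbids these different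
   parities. *)
have [P [Pf P1 P2 PV]] := two_vertex_cut dF kF d12 (erefl _) kG.
have := @cut_handshake (fun=> true) _ _ _ (fun=> erefl) _ Pf vne PV.
have := (P1 d erefl, P1 (r d) (rV _), P1 (r (r d)) (etrans (rV _) (rV _))).
have := (P2 k erefl, P2 (r k) (rV _), P2 (r (r k)) (etrans (rV _) (rV _))).
rewrite !(inj_eq (@perm_inj _ r)) !eqxx !rneq => -[[-> ->] ->] [[-> ->] ->].
have one h : \sum_(j | dvert ends j == dvert ends h) true = 0 :> bool.
  by rewrite (sum_vertex Hreg Hrot).
by move/(_ one); case: (P d); case: (P k).
Qed.

End OneFace.

(** * A face of the embedding [r] seen in the embedding [s] *)

Section TwoEmbeddings.
Variables (V E : finType) (ends : E -> bool -> V).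
Hypotheses (Hloop : loopless ends) (Hreg : four_regular ends)
  (H2c : two_connected ends).
Variables s r : {perm dart E}.
Hypotheses (Hs : planar_embedding ends s) (Hr : planar_embedding ends r).

Implicit Types d h k : dart E.

Let r4 := rotation4 Hreg Hr.1.
Let sneq := rotation_neq Hreg Hs.1.
Let rneq := rotation_neq Hreg Hr.1.
Let sV := dvert_rotation Hs.1.
Let rV := dvert_rotation Hr.1.

Variable d0 : dart E.
Let F := face r d0.
(* F runs into the vertex of d \in F through r^3 d and leaves through d. *)
Let straight d := s (s d) == r (r (r d)).

Lemma memF d k : d \in F -> dvert ends k = dvert ends d -> (k \in F) = (k == d).
Proof. exact: (mem_face_vertex Hloop Hreg H2c Hr.1 Hr.2). Qed.

Lemma even_straight_corners d1 : d1 \in F ->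
  \sum_(d in F | straight d && (r (r d) \in face r (r (r d1)))) true = 0 :> bool.
Proof.
move=> d1F; set G := face r _.
(* [z] is the indicator modulo 2 of the edges of [F], since [r d] and [flip d] lie on the same face
   of [r]. *)
pose z d : bool := (d \in F) + (r d \in F).
(* [A d] is the colour of the face of [s] through [d], in a 2-colouring that changes exactly across
   edges with [z = 1]. *)
have [d|d|d|A [Af As]] := @planar_cochain _ _ _ Hreg _ Hs.1 H2c Hs.2 z z.
- by rewrite /z -!mem_face_flip flipK addrC.
- rewrite big_split /=.
  have r3_inj : injective (fun k => r (r (r k))) by move=> h k /perm_inj/perm_inj/perm_inj.
  rewrite [X in _ + X](reindex_inj r3_inj) /=.
  under [X in _ + X]eq_bigl do rewrite !rV.
  by under [X in _ + X]eq_bigr do rewrite r4; case: (\sum_(k | _) _).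
- by apply: big1 => k _; rewrite /z -!mem_face_flip flipK; do 2!case: (_ \in F).
(* [G] has no edge in common with [F], so both sides of an edge of [G] have the same colour. *)
have zG g : g \in G -> (g \in F) = false /\ (r g \in F) = false.
  move=> gG; split; last first.
    rewrite -mem_face_flip; apply/negP=> gF.
    have := opposite_face_disjoint Hloop Hreg H2c Hr.1 Hr.2 d1F gF.
    by rewrite -mem_face_flip flipK gG.
  apply/negP=> gF; have : r (r d1) \in F.
    by rewrite /F -(face_eq gF) (face_eq gG) face_refl.
  by rewrite (memF d1F) ?rV // rneq.
(* At a corner of [G] opposite to [F], the two edge-ends outside [F] are separated in [s] by those
   of [F] precisely when the latter are opposite in [s]. At a vertex off [F] the colour is
   constant. *)
have corner k : k \notin F -> r k \notin F -> r (r k) \notin F ->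
    A (r k) + A k = (r (r (r k)) \in F) && straight (r (r (r k))).
  move=> kF rkF rrkF; have [|h'F] /= := boolP (r (r (r k)) \in F); last first.
    have zk m : dvert ends m = dvert ends k -> z m = 0.
      move/(rotation_vertexP Hreg Hr.1) => [] ->;
      by rewrite /z ?r4 ?(negPf kF) ?(negPf rkF) ?(negPf rrkF) ?(negPf h'F).
    have Ak m : dvert ends m = dvert ends k -> A (s m) = A m.
      by move=> mk; rewrite As zk // addr0.
    suff -> : A (r k) = A k by case: (A k).
    by case: (rotation_vertexP Hreg Hs.1 (rV k)) => ->; rewrite ?Ak // !sV.
  rewrite -{2 3}(r4 k); set d := r (r (r k)) => dF.
  have zE m : dvert ends m = dvert ends d -> z m = (m == d) + (r m == d).
    by move=> md; rewrite /z !(memF dF) // rV.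
  have z0 : z d = 1 by rewrite zE // eqxx rneq.
  have z1 : z (r d) = 0 by rewrite zE ?rV // !rneq.
  have z2 : z (r (r d)) = 0 by rewrite zE ?rV // !rneq.
  have z3 : z (r (r (r d))) = 1 by rewrite zE ?rV // r4 eqxx rneq.
  have e3 := rotation_vertexP Hreg Hs.1 (etrans (rV _) (etrans (rV _) (rV d))).
  have r12 : r d != r (r d) by rewrite rneq.
  have r10 : r d != d by rewrite rneq.
  have r20 : r (r d) != d by rewrite rneq.
  have r13 : r d != r (r (r d)) by rewrite rneq.
  have r23 : r (r d) != r (r (r d)) by rewrite rneq.
  have r30 : r (r (r d)) != d by rewrite rneq.
  rewrite /straight.
  (* Six cyclic orders of [s] remain; [d] and [r (r (r d))] are opposite in two of them. *)
  case: (rotation_vertexP Hreg Hs.1 (rV d)) => e1;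
  case: (rotation_vertexP Hreg Hs.1 (etrans (rV _) (rV d))) => e2;
  try (by rewrite e1 eqxx in r10); try (by rewrite e2 eqxx in r20);
  try (by rewrite e2 e1 eqxx in r12).
  - by rewrite -e2 (negPf r23) e2 e1 As -e1 z1; case: (A _).
  - have st : s (s d) = r (r (r d)).
      by case: e3 => // e3; [rewrite e3 eqxx in r30 | rewrite e3 e1 eqxx in r13
                            | rewrite e3 e2 eqxx in r23].
    by rewrite st eqxx e2 e1 !As -e1 z1 e1 st z3; case: (A _); case: (z _).
  - by rewrite -e1 (negPf r13) e2 e1 [A (s (s d))]As -e2 z2; case: (A _).
  - by rewrite -e1 (negPf r13) e2 e1 As -e1 z1; case: (A _).
  - have st : s (s d) = r (r (r d)).
      by case: e3 => // e3; [rewrite e3 eqxx in r30 | rewrite e3 e2 eqxx in r23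
                            | rewrite e3 e1 eqxx in r13].
    by rewrite st eqxx e2 e1 !As -e2 z2 e2 st z3; case: (A _); case: (z _).
  - by rewrite -e2 (negPf r23) e2 e1 [A (s (s (s d)))]As -e2 z2; case: (A _).
have step g : g \in G -> A (face_perm r g) + A g
    = (r (r (face_perm r g)) \in F) && straight (r (r (face_perm r g))).
  move=> gG; have gG' : face_perm r g \in G by rewrite mem_face_perm.
  have [gF gF'] := zG _ gG; have [gF1 gF2] := zG _ gG'.
  have -> : A g = A (flip g) by rewrite Af /z gF gF' !addr0.
  by apply: corner; rewrite ?mem_face_flip ?gF' //; [rewrite gF1|rewrite gF2].
have : \sum_(g in G) (A (face_perm r g) + A g) = 0.
  rewrite big_split /= [X in _ + X](reindex_inj (@face_perm_inj _ r)).
  under [X in _ + X]eq_bigl do rewrite mem_face_perm.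
  by case: (\sum_(d in G) _).
rewrite (eq_bigr _ step) => sumG; rewrite -[RHS]sumG.
(* The colour changes along the closed walk [G] cancel. Each [g] in [G] is matched with the edge-end
   [d] for which [r (r d)] is [face_perm r g]. *)
have rrphi_inj : injective (fun g => r (r (face_perm r g))).
  by move=> g h /perm_inj/perm_inj/face_perm_inj.
rewrite (reindex_inj rrphi_inj) big_mkcond [RHS]big_mkcond /=.
apply: eq_bigr => g _; rewrite r4 mem_face_perm -/G.
by case: (g \in G) (_ \in F) (straight _) => [] [] [].
Qed.

Variable x : dart E -> bool.
Hypotheses (xf : forall d, x (flip d) = x d) (xs : forall d, x (s (s d)) = x d).
Let y d := x d + x (s d).

Lemma sum_thread_change_face : \sum_(d in F) y d = 0.
Proof.
have xV d : \sum_(k | dvert ends k == dvert ends d) x k = 0.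
  by rewrite (sum_vertex Hreg Hs.1) !xs; do 2!case: (x _).
(* If [r (r (r d))] is next to [d] in [s], then [x] takes the value [x (s d)] there. In the straight
   case the first sum vanishes, and [r (r d)] is next to [d] in [s]. *)
have yE d : d \in F -> y d = x d + x (r (r (r d)))
    + (if straight d then x (r (r (r d))) + x (r (r d)) else 0).
  have r30 : r (r (r d)) != d by rewrite rneq.
  have xsss k : x (s (s (s k))) = x (s k) by rewrite xs.
  rewrite /straight /y => _.
  case: (rotation_vertexP Hreg Hs.1 (etrans (rV _) (etrans (rV _) (rV d)))) => e3.
  - by rewrite e3 eqxx in r30.
  - by rewrite e3 sneq addr0.
  - have r23 : r (r d) != r (r (r d)) by rewrite rneq.
    have r20 : r (r d) != d by rewrite rneq.
    rewrite e3 eqxx xs in r23 *.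
    case: (rotation_vertexP Hreg Hs.1 (etrans (rV _) (rV d))) => e2.
    + by rewrite e2 eqxx in r20.
    + by rewrite e2; do 2!case: (x _).
    + by rewrite e2 eqxx in r23.
    + by rewrite e2 xsss; do 2!case: (x _).
  - by rewrite e3 sneq xsss addr0.
have tele : \sum_(d in F) (x d + x (r (r (r d)))) = 0.
  rewrite big_split /= [X in _ + X](reindex_inj (@face_perm_inj _ r)).
  under [X in _ + X]eq_bigl do rewrite mem_face_perm.
  under [X in _ + X]eq_bigr do rewrite r4 xf.
  by case: (\sum_(d in F) _).
rewrite (eq_bigr _ yE) big_split /= tele add0r -big_mkcondr /=.
(* Straight corners are grouped by the face [G] opposite to [F]: in each group [y] is constant, and
   the group has even size. *)
rewrite (partition_big (fun d => face r (r (r d))) predT) //=.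
apply: big1 => G _.
have [d1|noG] := pickP [pred d | [&& d \in F, straight d & face r (r (r d)) == G]]; last first.
  by apply: big1 => d; have := noG d; rewrite /= andbA => ->.
case/and3P=> d1F st1 /eqP <-.
rewrite (eq_bigr (fun d => true * (x (r (r (r d1))) + x (r (r d1))))) => [|d]; last first.
  case/andP=> /andP[dF _] /eqP dG; rewrite mul1r.
  apply/esym/(opposite_corners_eq Hloop Hreg H2c Hr.1 Hr.2 xf xV d1F dF).
  by rewrite -dG face_refl.
rewrite -mulr_suml -[X in _ = X](mul0r (x (r (r (r d1))) + x (r (r d1)))).
congr (_ * _); rewrite -[RHS](even_straight_corners d1F).
apply: eq_bigl => d; rewrite -andbA; congr [&& _, _ & _].
apply/eqP/idP=> [<-|/face_eq//]; exact: face_refl.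
Qed.

End TwoEmbeddings.

(** * Moving thread-constant functions from one embedding to the other *)

Definition thread_constant (E : finType) (s : {perm dart E}) : {set {ffun E -> bool}} :=
  [set x : {ffun E -> bool} | [forall d, x (s (s d)).1 == x d.1]].

Lemma thread_constantP (E : finType) (s : {perm dart E}) (x : {ffun E -> bool}) :
  reflect (forall d, x (s (s d)).1 = x d.1) (x \in thread_constant s).
Proof. by rewrite inE; apply: (iffP forallP) => H d; apply/eqP. Qed.

Section Transfer.
Variables (V E : finType) (ends : E -> bool -> V).
Hypotheses (Hloop : loopless ends) (Hreg : four_regular ends)
  (H2c : two_connected ends).
Variables s r : {perm dart E}.
Hypotheses (Hs : planar_embedding ends s) (Hr : planar_embedding ends r).

(** The change [y] depends only on the vertex and sums to zero around each face of [r], so it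
    integrates in [r] to a function on edges. Two steps of [r] add [y] twice, so this function is
    constant along the threads of [r]. *)
Lemma thread_constant_transfer (e0 : E) x : x \in thread_constant s ->
  exists2 x', x' \in thread_constant r &
    x' e0 = x e0 /\ forall d, x' d.1 + x' (r d).1 = x d.1 + x (s d).1.
Proof.
move=> /thread_constantP xs.
pose y (d : dart E) : bool := x d.1 + x (s d).1.
have ys d : y (s d) = y d by rewrite /y xs addrC.
have yV d k : dvert ends k = dvert ends d -> y k = y d.
  by case/(rotation_vertexP Hreg Hs.1) => ->; rewrite ?ys.
have rV := dvert_rotation Hr.1.
have [//|d|d|A [Af Ar]] := @planar_cochain _ _ _ Hreg _ Hr.1 H2c Hr.2 (fun=> 0) y.
- by rewrite (sum_vertex Hreg Hr.1) ![y (r _)](yV d) ?rV //; case: (y d).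
- rewrite -[RHS](@sum_thread_change_face _ _ _ Hloop Hreg H2c s r Hs Hr d (fun d => x d.1)) //.
  rewrite [RHS](reindex_inj (@face_perm_inj _ r)).
  under [RHS]eq_bigl do rewrite mem_face_perm.
  by apply: eq_bigr => k _; rewrite add0r -/(y _) (yV (flip k)) // rV.
have A1 d : A (d.1, true) = A d.
  by case: d => e [] //=; have := Af (e, true); rewrite addr0 => <-.
(* The added constant makes the value at [e0] equal to [x e0]. *)
exists [ffun e => A (e, true) + A (e0, true) + x e0].
  apply/thread_constantP => d; rewrite !ffunE !A1 !Ar (yV d) ?rV //.
  by case: (A d); case: (y d).
split=> [|d]; rewrite !ffunE; first by case: (A _); case: (x _).
by rewrite !A1 Ar -/(y d); case: (A d); case: (y d); case: (A _); case: (x _).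
Qed.

(** The transfer is injective: a function on edges is determined by its changes at vertices and its
    value at one edge, the graph being connected. *)
Lemma leq_thread_constant : (#|thread_constant s| <= #|thread_constant r|)%N.
Proof.
have [v _] : exists v : V, v \in V by apply/card_gt0P/(leq_trans _ H2c.1).
have [[e0 b] _] := vertex_dart Hreg v.
have [tau tauP] : exists tau : {ffun E -> bool} -> {ffun E -> bool},
    forall x, x \in thread_constant s -> tau x \in thread_constant r /\
    tau x e0 = x e0 /\ forall d : dart E, tau x d.1 + tau x (r d).1 = x d.1 + x (s d).1.
  apply: (fin_all_exists (P := fun x x' => x \in thread_constant s ->
    x' \in thread_constant r /\ x' e0 = x e0 /\
    forall d : dart E, x' d.1 + x' (r d).1 = x d.1 + x (s d).1)) => x.
  have [/(thread_constant_transfer e0)[x' ? ?]|_] := boolP (x \in thread_constant s).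
    by exists x'.
  by exists x.
have tau_inj : {in thread_constant s &, injective tau}.
  move=> x1 x2 /tauP[_ [x1e x1d]] /tauP[_ [x2e x2d]] eq_tau; apply/ffunP=> e.
  have := @locally_constant _ _ _ Hreg s Hs.1 H2c _ (fun d => x1 d.1 + x2 d.1)
    (fun=> erefl) _ (e, b) (e0, b).
  rewrite /= -x1e -x2e eq_tau => e12; have {e12} : x1 e + x2 e = 0.
    rewrite e12 => [|d]; first by case: (tau x2 e0).
    by move: (x1d d); rewrite eq_tau x2d; case: (x1 _); case: (x1 _); case: (x2 _); case: (x2 _).
  by case: (x1 e); case: (x2 e).
rewrite -(card_in_imset tau_inj); apply/subset_leq_card/subsetP=> _ /imsetP[x xs ->].
by have [] := tauP x xs.
Qed.

End Transfer.

(** * Counting thread-constant functions by circuits *)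

Lemma count1_nth_inj (T : Type) (a : pred T) (x0 : T) (c : seq T) i j :
  count a c = 1%N -> (i < size c)%N -> (j < size c)%N ->
  a (nth x0 c i) -> a (nth x0 c j) -> i = j.
Proof.
have nth0 (c' : seq T) m : count a c' = 0%N -> (m < size c')%N -> a (nth x0 c' m) = false.
  move=> c0 mc; apply/negbTE; have : all (predC a) c' by rewrite all_predC has_count c0.
  by move/all_nthP=> /(_ x0 m mc).
elim: c i j => [|z c IHc] [|i] [|j] //=; case: (a z) => //= c1 ic jc.
- by rewrite nth0 //; case: c1.
- by rewrite nth0 //; case: c1.
- by rewrite nth0 //; case: c1.
- by move=> ai aj; congr _.+1; apply: IHc.
Qed.

Lemma same_edge_flip (E : finType) (d k : dart E) : d.1 = k.1 -> d = k \/ d = flip k.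
Proof.
case: d k => e b [e' b'] /= ->; rewrite /flip /=.
by case: b; case: b'; [left|right|right|left].
Qed.

(** Composition with [idx], which sends an edge to its circuit, is a bijection from functions on
    circuits to thread-constant functions. *)
Lemma card_thread_constant (V E : finType) (ends : E -> bool -> V)
    (s : {perm dart E}) (C : seq (seq (dart E))) :
  four_regular ends -> rotation_system ends s -> threaded_circuit_partition s C ->
  #|thread_constant s| = (2 ^ size C)%N.
Proof.
move=> Hreg Hrot [HC Ccount].
pose onC (e : E) (c : seq (dart E)) := e \in map fst c.
have idxP e : (find (onC e) C < size C)%N by rewrite -has_find has_count Ccount.
pose idx e : 'I_(size C) := Ordinal (idxP e).
have onidx e : onC e (nth [::] C (idx e)).
  by apply: (nth_find [::]); rewrite has_find.
have idxE e (i : 'I_(size C)) : onC e (nth [::] C i) -> idx e = i.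
  move=> ei; apply: val_inj; exact: (count1_nth_inj (Ccount e) (idxP e) (ltn_ord i) (onidx e) ei).
have edge i : exists e, idx e = i.
  have [] := HC _ (mem_nth [::] (ltn_ord i)).
  case ci: (nth [::] C i) => [//|d c] _ _ _; exists d.1.
  by apply: idxE; rewrite ci /onC mem_head.
pose g (x : {ffun 'I_(size C) -> bool}) : {ffun E -> bool} := [ffun e => x (idx e)].
have g_inj : injective g.
  move=> x1 x2 /ffunP eqg; apply/ffunP=> i; have [e <-] := edge i.
  by have := eqg e; rewrite !ffunE.
(* The circuit passes through the edge of [d] as [d] or as [flip d]. The other edge of the thread is
   then the previous or the next one on the circuit. *)
have idx_thread d : idx (s (s d)).1 = idx d.1.
  apply: idxE; have := onidx d.1; set c := nth _ _ _.
  have [_ _ cyc] := HC c (mem_nth _ (idxP _)).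
  rewrite /onC; case/mapP=> k kc dk.
  have [->|dfk] := same_edge_flip dk.
  - have := prev_cycle cyc kc; rewrite /threaded_step /is_thread => /eqP kE.
    rewrite [in s (s k)]kE (rotation4 Hreg Hrot); apply/mapP.
    by exists (path.prev c k); rewrite ?mem_prev.
  - have := next_cycle cyc kc; rewrite /threaded_step /is_thread -dfk => /eqP <-.
    by apply/mapP; exists (path.next c k); rewrite ?mem_next.
rewrite -[in RHS](card_ord (size C)) -card_bool -card_ffun -(card_imset predT g_inj).
apply: eq_card => x; apply/thread_constantP/imsetP => [xs|[z _ ->] d]; last first.
  by rewrite !ffunE idx_thread.
have [e_ e_P] := fin_all_exists edge.
exists [ffun i => x (e_ i)] => //; apply/ffunP=> e; rewrite !ffunE.
have := e_P (idx e); move: (e_ (idx e)) => e' ee'.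
have [_ _ cyc] := HC (nth [::] C (idx e)) (mem_nth _ (idxP _)).
have := onidx e; have := onidx e'; rewrite ee'.
move: (nth [::] C (idx e)) cyc => c cyc /mapP[k' k'c ->] /mapP[k kc ->].
(* The circuit is rotated to start at [k], and [x] is carried along the path from there. *)
case/rot_to: kc => i c' rc.
have : path.cycle (threaded_step s) (k :: c') by rewrite -rc rot_cycle.
have : k' \in k :: c' by rewrite -rc mem_rot.
suff pathE h p : path (threaded_step s) h p -> forall j, j \in h :: p -> x j.1 = x h.1.
  by move=> k'c' /=; rewrite rcons_path => /andP[/pathE/(_ _ k'c') ->].
elim: p h => [|z p IHp] h /=; first by move=> _ j; rewrite inE => /eqP->.
case/andP=> /eqP hz /IHp{}IHp j; rewrite inE => /predU1P[->//|/IHp ->].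
by rewrite hz xs.
Qed.

Theorem mainTheorem3 (V E : finType) (ends : E -> bool -> V)
  (Hloop : loopless ends) (Hreg : four_regular ends) (H2c : two_connected ends)
  (sigma sigma' : {perm dart E})
  (Hs : planar_embedding ends sigma) (Hs' : planar_embedding ends sigma')
  (C C' : seq (seq (dart E)))
  (HC : threaded_circuit_partition sigma C)
  (HC' : threaded_circuit_partition sigma' C') :
  size C = size C'.
Proof.
(* It suffices to compare powers of 2; the inequality of cardinalities holds in both directions by
   symmetry. *)
apply/eqP; rewrite -(eqn_exp2l _ _ (ltnSn 1)).
rewrite -(card_thread_constant Hreg Hs.1 HC) -(card_thread_constant Hreg Hs'.1 HC').
by rewrite eqn_leq !(leq_thread_constant Hloop Hreg H2c).
Qed.
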